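(* For every bounded turning Jordan arc $\gamma$, there exist subsets $R,U\subset\gamma$ such that $R$ is countably $1$-rectifiable, $U$ is purely $1$-unrectifiable, and $\gamma=R\cup U$.
   Context: A Jordan arc is a metric space homeomorphic to $[0,1]$. A metric space is bounded turning if there is $B\ge1$ such that every pair of points $u,v$ is contained in a compact connected set $E$ with $\operatorname{diam}(E)\le B\,d(u,v)$. A metric space $X$ is countably $1$-rectifiable if there exist countably many subsets $A_i\subset\mathbb{R}$ and Lipschitz maps $f_i:A_i\to X$ such that $\mathcal{H}^1\big(X\setminus\bigcup_i f_i(A_i)\big)=0$, where $\mathcal{H}^1$ is the Hausdorff $1$-measure. A metric space is purely $1$-unrectifiable if it contains no bi-Lipschitz copy of a positive (Lebesgue) measure subset of $\mathbb{R}$. Subsets of $\gamma$ carry the restricted metric. *)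

(* Defs.v *)
(* MathComp-Analysis *)
From HB Require Import structures.
From mathcomp Require Import all_boot all_order all_algebra.
From mathcomp Require Import all_classical all_reals all_analysis.
From mathcomp Require Import measurable_realfun.

Set Implicit Arguments.
Unset Strict Implicit.
Unset Printing Implicit Defensive.

Import Order.TTheory GRing.Theory Num.Theory.
Import numFieldNormedType.Exports.

Local Open Scope classical_set_scope.
Local Open Scope ring_scope.

(* The restricted metric on a subset [A], seen as the type [set_type A]; it
   completes the pseudometric structure that the library already puts there. *)
Section restricted_metric.
Context {R : realType} {X : metricType R} (A : set X).

Definition set_type_mdist (x y : set_type A) : R :=
  mdist (set_val x) (set_val y).

Lemma set_type_mdist_ge0 x y : 0 <= set_type_mdist x y.
Proof. exact: mdist_ge0. Qed.

Lemma set_type_mdist_positivity x y : set_type_mdist x y = 0 -> x = y.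
Proof. by move=> /mdist_positivity/val_inj. Qed.

Lemma set_type_ballEmdist (x : set_type A) (d : R) :
  ball x d = [set y | set_type_mdist x y < d].
Proof.
change (set_val @^-1` ball (set_val x) d = [set y | set_type_mdist x y < d]).
by rewrite ballEmdist.
Qed.

HB.instance Definition _ := @PseudoMetric_isMetric.Build R (set_type A)
  set_type_mdist set_type_mdist_ge0 set_type_mdist_positivity
  set_type_ballEmdist.

End restricted_metric.

Definition homeomorphic (X Y : topologicalType) :=
  exists (f : X -> Y) (g : Y -> X),
    [/\ continuous f, continuous g, cancel f g & cancel g f].

(* Subsets of the line are taken in [R^o], which is where the library declares
   the metric |y - x|. *)
Definition jordan_arc {R : realType} (X : metricType R) :=
  homeomorphic X (set_type (`[0, 1]%classic : set R^o)).

Section metric_notions.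
Context {R : realType}.

(* The 0 only matters for the empty set, where the bare supremum is -oo. *)
Definition diam (X : metricType R) (E : set X) : \bar R :=
  ereal_sup (0%E |` [set (mdist p.1 p.2)%:E | p in E `*` E]).

Definition bounded_turning (X : metricType R) :=
  exists2 B : R, 1 <= B &
    forall u v : X, exists E : set X,
      [/\ compact E, connected E, E u, E v &
          (diam E <= (B * mdist u v)%:E)%E].

(* Normalized so that [hausdorff1] agrees with length on the line. *)
Definition hausdorff1_pre (X : metricType R) (d : R) (E : set X) : \bar R :=
  ereal_inf [set (\sum_(0 <= k <oo) diam (F k))%E | F in
    [set F : (set X)^nat |
      E `<=` \bigcup_k F k /\ forall k, (diam (F k) <= d%:E)%E]].

Definition hausdorff1 (X : metricType R) (E : set X) : \bar R :=
  ereal_sup [set hausdorff1_pre d E | d in [set d : R | 0 < d]].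

Definition lipschitz_map (X Y : metricType R) (f : X -> Y) :=
  exists L : R, forall x y, mdist (f x) (f y) <= L * mdist x y.

Definition bilipschitz_map (X Y : metricType R) (f : X -> Y) :=
  exists2 L : R, 1 <= L & forall x y,
    L^-1 * mdist x y <= mdist (f x) (f y) <= L * mdist x y.

Definition countably_1_rectifiable (X : metricType R) :=
  exists (A : nat -> set R^o) (f : forall i, set_type (A i) -> X),
    (forall i, lipschitz_map (f i)) /\
    hausdorff1 (~` \bigcup_i range (f i)) = 0%E.

(* Borel up to a null set: [measurable] on the line is Borel measurability. *)
Definition lebesgue_measurable (E : set R) :=
  (completed_algebra_gen (@lebesgue_measure R)).-sigma.-measurable E.

Definition purely_1_unrectifiable (X : metricType R) :=
  ~ exists (E : set R^o) (f : set_type E -> X),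
      [/\ lebesgue_measurable E, (0 < completed_lebesgue_measure E)%E &
          bilipschitz_map f].

End metric_notions.

(* Main.v *)
Require Import Defs.
From HB Require Import structures.
From mathcomp Require Import all_boot all_order all_algebra.
From mathcomp Require Import all_classical all_reals all_analysis.
From mathcomp Require Import measurable_realfun lra ring.

Set Implicit Arguments.
Unset Strict Implicit.
Unset Printing Implicit Defensive.

Import Order.TTheory GRing.Theory Num.Theory.
Import numFieldNormedType.Exports.

Local Open Scope classical_set_scope.
Local Open Scope ring_scope.

(** Call a piece the image f(K) of a compact set K of positive measure under a
bi-Lipschitz map f into the arc. It is enough to find countably many pieces
such that every piece meets one of them: their union is the rectifiable part,
and the complement contains no piece, hence is purely unrectifiable, because a
Lebesgue measurable set of positive measure contains a compact set of positive
measure ([lebesgue_measurable_compact_sub]).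

Such a family exists because two pieces that almost fill a common subarc must
meet. Fix a parametrization c of the arc. A set P almost fills the subarc from
c(p) to c(q) when the distances to c(p) of the points of the subarc outside P
form a set of outer measure less than half of d(c(p), c(q)). The distances to
c(p) of all points of the subarc cover the interval from 0 to d(c(p), c(q)),
so two such sets cannot be disjoint ([almost_fills_meet]). Choosing one piece
for each pair of rationals (p, q) for which some piece almost fills the
subarc, the family meets every piece that almost fills some rational subarc.

Every piece does ([bilipschitz_almost_fills]). Around a Lebesgue density point,
there are a < b in K such that the gaps of K between a and b have total length
much smaller than b - a ([compact_nearly_fills_interval]). A point of the
subarc between f(a) and f(b) that is not in f(K) lies between the images f(a')
and f(b') of the two ends of a gap, by an intermediate value argument
([IVT_gap]). By bounded turning, its distance to
f(a') is at most a constant times b' - a'. Hence the distances to c(p) of the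
points that are missed lie in intervals around countably many values, one for
each gap, of total length at most a constant times that of the gaps
([measure_near_gaps]). On the other hand, d(f(a), f(b)) is at least b - a up to
a constant, and so is d(c(p), c(q)) if p and q are close to the parameters of
f(a) and f(b) ([rational_chord]). *)

(** * Gaps of a compact subset of the line *)
Section line.
Context {R : realType}.
Implicit Types (K : set R) (w : R -> R) (a b v : R).

Local Notation mu := (@lebesgue_measure R).

Definition gap K a b := [/\ K a, K b, a < b & K `&` `]a, b[ = set0].

Definition continuous_on K w := forall x e, K x -> 0 < e ->
  exists2 d, 0 < d & forall y, K y -> `|x - y| < d -> `|w x - w y| < e.

Lemma continuous_onN K w : continuous_on K w -> continuous_on K (- w).
Proof.
move=> cw x e Kx e0; have [d d0 dw] := cw x e Kx e0.
by exists d => // y Ky /(dw y Ky); rewrite !fctE -opprD normrN.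
Qed.

(** Sublevel sets of a function that is continuous on K only: their extreme
elements are the ends of the gaps found in [IVT_gap_up]. *)
Lemma compact_sublevel K w a b v : compact K -> continuous_on K w ->
  compact (K `&` `[a, b] `&` [set x | w x <= v]).
Proof.
move=> cK cw; apply: (subclosed_compact _ cK); last by move=> x [[]].
have clK : closed K by apply: compact_closed => //; exact: Rhausdorff.
move=> x clx; have [Kx abx] : (K `&` `[a, b]) x.
  have : closed (K `&` `[a, b]%classic).
    by apply: closedI => //; exact: interval_closed.
  by apply; apply: closure_subset clx => y [].
split=> //=; rewrite leNgt; apply/negP => vx.
have [d d0 dw] := cw x (w x - v) Kx ltac:(by rewrite subr_gt0).
have [y [[[Ky _] /= wy] xy]] := clx _ (nbhsx_ballx x d d0).
have := dw y Ky xy; apply/negP; rewrite -leNgt.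
by apply: le_trans (ler_norm _); lra.
Qed.

Lemma compact_has_max K : compact K -> K !=set0 ->
  exists2 m, K m & forall x, K x -> x <= m.
Proof.
move=> cK K0; have [|m mK mM] := @compact_EVT_max _ R id K K0 cK.
  by apply: continuous_subspaceT => x; exact: cvg_id.
by exists m => [|x Kx]; [exact: set_mem|apply: mM; exact: mem_set].
Qed.

Lemma compact_has_min K : compact K -> K !=set0 ->
  exists2 m, K m & forall x, K x -> m <= x.
Proof.
move=> cK K0; have [|m mK mM] := @compact_EVT_min _ R id K K0 cK.
  by apply: continuous_subspaceT => x; exact: cvg_id.
by exists m => [|x Kx]; [exact: set_mem|apply: mM; exact: mem_set].
Qed.

(** The gap begins at the last point of K in [a, b] where w is below v, and ends
at the first later point of K where w is above v. *)
Lemma IVT_gap_up K w a b v : compact K -> continuous_on K w ->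
    K a -> K b -> a < b -> w a < v < w b -> ~ (w @` K) v ->
  exists a' b', [/\ a <= a', b' <= b, gap K a' b' & w a' < v < w b'].
Proof.
move=> cK cw Ka Kb ab /andP[wav vwb] nv.
have neq x : K x -> w x <> v by move=> Kx wx; apply: nv; exists x.
have [|a' [[Ka' /itvP a'i] wa'] maxa] :=
    compact_has_max (@compact_sublevel K w a b v cK cw).
  by exists a; split=> /=; [split; rewrite //= in_itv/= lexx ltW|exact: ltW].
have aa' : a <= a' by rewrite a'i.
have {wa'} wa'v : w a' < v by rewrite lt_neqAle wa' andbT; exact/eqP/neq.
have [|b' [[Kb' /itvP b'i] wb'] minb] :=
    compact_has_min (@compact_sublevel K (- w) a' b (- v) cK (continuous_onN cw)).
  exists b; split=> /=; first by split; rewrite //= in_itv/= lexx a'i.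
  by rewrite fctE lerN2 ltW.
have a'b' : a' <= b' by rewrite b'i.
have b'b : b' <= b by rewrite b'i.
have vwb' : v < w b'.
  rewrite lt_neqAle; apply/andP; split; first by apply/eqP => /esym; exact: neq.
  by move: wb'; rewrite /= fctE lerN2.
exists a', b'; split=> //; last by rewrite wa'v.
split=> //.
  rewrite lt_neqAle a'b' andbT; apply: contraTneq wa'v => ->.
  by rewrite -leNgt ltW.
rewrite -subset0 => x [Kx]; rewrite /= in_itv/= => /andP[a'x xb'].
case: (leP (w x) v) => wx.
  have : x <= a'.
    apply: maxa; split=> //=; split=> //=; rewrite in_itv/=.
    by rewrite (le_trans aa' (ltW a'x)) (le_trans (ltW xb') b'b).
  by rewrite leNgt a'x.
have : b' <= x.
  apply: minb; split=> /=; last by rewrite fctE lerN2 ltW.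
  by split=> //=; rewrite in_itv/= ltW//= (le_trans (ltW xb') b'b).
by rewrite leNgt xb'.
Qed.

(** Both orientations are needed, since the map to which the lemma is applied
may be increasing at some places and decreasing at others. *)
Lemma IVT_gap K w a b v : compact K -> continuous_on K w ->
    K a -> K b -> a < b -> w a < v < w b \/ w b < v < w a ->
    ~ (w @` K) v ->
  exists a' b', [/\ a <= a', b' <= b, gap K a' b' &
    w a' < v < w b' \/ w b' < v < w a'].
Proof.
move=> cK cw Ka Kb ab [vab|vab] nv.
  have [a' [b' [? ? ? ?]]] := IVT_gap_up cK cw Ka Kb ab vab nv.
  by exists a', b'; split=> //; left.
have [||a' [b' [aa' b'b gab]]] :=
    @IVT_gap_up K (- w) a b (- v) cK (continuous_onN cw) Ka Kb ab.
- by rewrite !fctE !ltrN2 andbC.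
- by case=> x Kx /oppr_inj wx; apply: nv; exists x.
rewrite !fctE !ltrN2 andbC => vab'.
by exists a', b'; split=> //; right.
Qed.

(** The trace of I k on A is clopen in A, because the other members of the family
have an open union. *)
Lemma connected_sub_trivIset (A : set R) (I : nat -> set R) k x :
    connected A -> A `<=` \bigcup_n I n -> (forall n, open (I n)) ->
    trivIset setT I -> A x -> I k x -> A `<=` I k.
Proof.
move=> cA AI oI tI Ax Ikx.
suff -> : A = A `&` I k by move=> y [].
apply/esym/cA; first by exists x.
  by exists (I k).
exists (~` \bigcup_(n in [set n | n != k]) I n).
  by apply: open_closedC; apply: bigcup_open => n _.
apply/seteqP; split=> y [Ay Iy]; split=> //.
  move=> [n /= nk Iny]; move/eqP: nk; apply.
  by apply: (tI n k) => //; exists y.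
have [n _ Iny] := AI y Ay; have [<-//|nk] := eqVneq n k.
by case: Iy; exists n.
Qed.

(** A gap is connected and its ends lie outside the open set, so it is exactly
one of the disjoint open intervals whose union is that set. *)
Lemma gap_component K a b (I : nat -> set R) a' b' :
    `]a, b[ `\` K = \bigcup_n I n -> (forall n, open (I n) /\ is_interval (I n)) ->
    trivIset setT I -> a <= a' -> b' <= b -> gap K a' b' ->
  exists k, I k = `]a', b'[%classic.
Proof.
move=> UI oI tI aa' b'b [Ka' Kb' ab' Kab].
have subU : `]a', b'[ `<=` \bigcup_n I n.
  rewrite -UI => x abx; split.
    by move: abx; rewrite /= !in_itv/= => /andP[? ?]; apply/andP; split;
      [exact: le_lt_trans aa' _|exact: lt_le_trans b'b].
  by move=> Kx; have : (set0 : set R) x by rewrite -Kab.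
have notin k x : K x -> ~ I k x.
  move=> Kx Ikx; have : (`]a, b[ `\` K) x by rewrite UI; exists k.
  by case.
have abm : `]a', b'[%classic ((a' + b') / 2) by rewrite /= in_itv/=; apply/andP; split; lra.
have [k _ Ikm] := subU _ abm.
exists k; apply/seteqP; split; last first.
  apply: connected_sub_trivIset abm Ikm => //; last by move=> n; case: (oI n).
  exact/connected_intervalP/interval_is_interval.
move=> x Ikx; have [_ itvI] := oI k.
rewrite /= in_itv/=; move: abm; rewrite /= in_itv/= => /andP[am mb].
apply/andP; split; rewrite ltNge; apply/negP => h.
  by apply: (notin k _ Ka'); apply: (itvI _ _ Ikx Ikm); rewrite h ltW.
by apply: (notin k _ Kb'); apply: (itvI _ _ Ikm Ikx); rewrite h ltW.
Qed.

(** Each gap contributes an interval of length 2 C times its own length, centred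
at the value of u at its left end. Distinct gaps being disjoint, the total
length of the gaps is the measure of the part of ]a, b[ outside K. The measure
is used as an outer measure, since T may fail to be measurable. *)
Lemma measure_near_gaps K a b (u : R -> R) (C : R) (T : set R) :
    closed K -> 0 <= C ->
    (forall y, T y -> exists a' b',
      [/\ a <= a', b' <= b, gap K a' b' & `|u a' - y| <= C * (b' - a')]) ->
  (mu T <= (2 * C)%:E * mu (`]a, b[ `\` K))%E.
Proof.
move=> clK C0 Tgap; set O := `]a, b[ `\` K.
have oO : open O.
  by apply: openI; [exact: interval_open|exact: closed_openC].
have [I [oI tI UI]] := OpenSetDisjointItvs.open_disjoint_itv oO.
pose W k := [set y | exists a' b',
  [/\ a' < b', I k = `]a', b'[%classic & `|u a' - y| <= C * (b' - a')]].
have TW : T `<=` \bigcup_k W k.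
  move=> y /Tgap[a' [b' [aa' b'b gab uy]]].
  have [k Ik] := gap_component UI oI tI aa' b'b gab.
  by exists k => //; exists a', b'; split=> //; case: gab.
(* The interval I k determines its ends, so W k is a single interval. *)
have muW k : (mu (W k) <= (2 * C)%:E * mu (I k))%E.
  have [W0|] := pselect (W k = set0).
    by rewrite W0 measure0 mule_ge0// lee_fin mulr_ge0.
  move/eqP/set0P => [_ [a' [b' [ab' Ik _]]]].
  have infI : inf (I k) = a' by rewrite Ik inf_itv.
  have muI : mu (I k) = (b' - a')%:E.
    by rewrite Ik lebesgue_measure_itv/= lte_fin ab' EFinB.
  set l := C * (b' - a').
  have l0 : 0 <= l by rewrite mulr_ge0// subr_ge0 ltW.
  apply: (@le_trans _ _ (mu `[u a' - l, u a' + l]%classic)).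
    apply: le_outer_measure => y [a2 [b2 [ab2 Ik2]]].
    have ea2 : a2 = a' by rewrite -infI Ik2 inf_itv.
    have -> : b2 - a2 = b' - a'.
      apply: EFin_inj; rewrite -muI Ik2 lebesgue_measure_itv/= lte_fin ab2.
      by rewrite EFinB.
    by rewrite -/l ea2 ler_distlC /= in_itv/=.
  rewrite lebesgue_measure_itv/= muI; case: ifPn => _.
    by rewrite -EFinB -EFinM lee_fin /l; lra.
  by rewrite -EFinM lee_fin /l -mulrA mulr_ge0.
apply: (@le_trans _ _ (\sum_(0 <= k <oo) mu (W k))%E).
  apply: le_trans (outer_measure_sigma_subadditive mu W).
  exact: le_outer_measure.
apply: (@le_trans _ _ (\sum_(0 <= k <oo) ((2 * C)%:E * mu (I k)))%E).
  by apply: lee_nneseries => k _ //; exact: outer_measure_ge0.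
rewrite nneseriesZl//.
rewrite -/O UI measure_bigcup//; last first.
  by move=> k _; apply: open_measurable; case: (oI k).
rewrite le_eqVlt; apply/predU1P; left; congr (_ * _)%E.
by apply: eq_eseriesl => k; rewrite in_setT.
Qed.

(** Near a density point x of K, take for a and b the extreme points of K in a
small interval [x - r, x + r]. *)
Lemma compact_nearly_fills_interval K (e : R) : compact K -> (0 < mu K)%E -> 0 < e ->
  exists a b, [/\ K a, K b, a < b &
    (mu (`]a, b[ `\` K) <= (e * (b - a))%:E)%E].
Proof.
move=> cK K0 e0.
have clK : closed K by apply: compact_closed => //; exact: Rhausdorff.
have mK : measurable K by exact: closed_measurable.
have [x [Kx dx]] : exists x, K x /\
    (mu (K `&` ball x r) * (mu (ball x r))^-1 @[r --> (0:R)^'+] --> 1)%E.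
  apply/not_existsP => nK; have := @lebesgue_density R K mK.
  move=> [N [mN N0 nN]]; suff : (mu K <= 0)%E by rewrite leNgt K0.
  rewrite -N0; apply: le_outer_measure => x Kx; apply: nN => /= dx.
  by apply: (nK x); split=> //; move: dx; rewrite indicE mem_set.
(* The density c for which the missing proportion 1 - c is e times c. *)
set c := (1 + e)^-1.
have c0 : 0 < c by rewrite invr_gt0; lra.
have c1 : (c%:E < 1)%E.
  by rewrite lte_fin invf_lt1; lra.
have oc : nbhs 1%E [set y | (c%:E < y)%E].
  by apply: open_nbhs_nbhs; split=> //; exact: open_ereal_gt_ereal.
have dxc : \forall r \near (0:R)^'+,
    (c%:E < mu (K `&` ball x r) * (mu (ball x r))^-1)%E by exact: dx _ oc.
have [r [/= cr r0]] := filter_ex (filterI dxc (nbhs_right_gt (0:R))).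
have mB : measurable (ball x r) by exact: measurable_ball.
have muB : mu (ball x r) = (r *+ 2)%:E by rewrite lebesgue_measure_ball// ltW.
have muKB : ((c * (r *+ 2))%:E < mu (K `&` ball x r))%E.
  move: cr; rewrite muB inver gt_eqF ?pmulrn_lgt0// => cr.
  by rewrite EFinM -lte_pdivlMr// pmulrn_lgt0.
pose J := K `&` `[x - r, x + r].
have cJ : compact J.
  by apply: subclosed_compact cK _; [apply: closedI => //; exact: interval_closed
    |move=> ? []].
have BJ : K `&` ball x r `<=` J.
  by move=> y [Ky]; rewrite ball_itv /= => xy; split=> //; exact: subset_itv_oo_cc xy.
have J0 : J !=set0.
  by exists x; apply: BJ; split=> //; exact: ballxx.
have [a [Ka /itvP ai] aJ] := compact_has_min cJ J0.
have [b [Kb /itvP bi] bJ] := compact_has_max cJ J0.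
have abr : c * (r *+ 2) < b - a.
  have : (mu (K `&` ball x r) <= mu `[a, b])%E.
    by apply: le_outer_measure => y /BJ Jy; rewrite /= in_itv/= aJ// bJ.
  rewrite lebesgue_measure_itv/= => /(lt_le_trans muKB).
  case: ifPn => [_|_]; first by rewrite -EFinB lte_fin.
  by rewrite lte_fin ltNge mulr_ge0// ?ltW// pmulrn_lgt0.
have r20 : 0 < r *+ 2 by rewrite pmulrn_lgt0.
exists a, b; split=> //; first by rewrite -subr_gt0 (lt_trans _ abr)// mulr_gt0.
have muD : (mu (ball x r `\` K) <= (r *+ 2 - c * (r *+ 2))%:E)%E.
  rewrite measureD//= muB; last by rewrite ltry.
  by rewrite setIC EFinB leeB// ltW.
apply: (@le_trans _ _ (mu (ball x r `\` K))).
  apply: le_outer_measure => y [/itvP yab nKy]; split=> //.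
  rewrite ball_itv /= in_itv/=; apply/andP; split.
    by apply: (@le_lt_trans _ _ a); rewrite ?ai ?yab.
  by apply: (@lt_le_trans _ _ b); rewrite ?bi ?yab.
apply: (le_trans muD); rewrite lee_fin.
apply: (@le_trans _ _ (e * (c * (r *+ 2)))); last by rewrite ler_pM2l// ltW.
have sE : r *+ 2 = c * (r *+ 2) + e * (c * (r *+ 2)).
  have cE : (1 + e) * c = 1 by rewrite divff//; apply: lt0r_neq0; lra.
  by rewrite -[LHS]mul1r -cE mulrDl mul1r mulrDl mulrA.
by rewrite {1}sE; lra.
Qed.
End line.

(** * Subarcs almost filled by a set *)

Section arcs.
Context {R : realType} {X : metricType R}.
Implicit Types (c : R -> X) (h : X -> R) (P Q : set X) (K : set R).

Local Notation mu := (@lebesgue_measure R).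

(** The parametrization c is a path on the whole line, of which only the part over
[0, 1] is meaningful: this avoids subtypes. *)
Definition arc_chart c h :=
  [/\ continuous c, continuous h, forall x, 0 <= h x <= 1, cancel h c &
      forall t, 0 <= t <= 1 -> h (c t) = t].

Lemma jordan_arc_chart : jordan_arc X -> exists c h, arc_chart c h.
Proof.
move=> [f [g [cf cg fK gK]]].
pose clamp (t : R) : R := Num.max 0 (Num.min 1 t).
have clampP t : clamp t \in (`[0, 1]%classic : set R^o).
  rewrite mem_setE in_itv/= /clamp le_max lexx/= ge_max ler01/=.
  by rewrite ge_min lexx.
pose pt t : set_type (`[0, 1]%classic : set R^o) := exist _ (clamp t) (clampP t).
have cpt : continuous (pt : R -> _).
  have cc : continuous (clamp : R -> R).
    move=> t; apply: (@continuous_max R R (fun _ => 0) (fun t => Num.min 1 t)).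
      exact: cst_continuous.
    apply: (@continuous_min R R (fun _ => 1) id); first exact: cst_continuous.
    exact: cvg_id.
  exact: (@continuous_comp_initial _ _ _ set_val pt cc).
exists (g \o pt), (set_val \o f); split.
- by move=> t; apply: continuous_comp; [exact: cpt|exact: cg].
- by move=> x; apply: continuous_comp; [exact: cf|exact: initial_continuous].
- by move=> x; have := set_valP (f x); rewrite /= in_itv.
- move=> x /=; rewrite -[RHS]fK; congr g; apply: val_inj => /=.
  have := set_valP (f x); rewrite /= in_itv /= => /andP[t0 t1].
  by rewrite /clamp min_r// max_r.
- move=> t /andP[t0 t1]; rewrite /= gK -[LHS]/(clamp t).
  by rewrite /clamp min_r// max_r.
Qed.

Lemma path_continuous_dist c s (e : R) : continuous c -> 0 < e ->
  exists2 d, 0 < d & forall t, `|s - t| < d -> mdist (c s) (c t) < e.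
Proof.
move=> cc e0.
have : \forall t \near s, mdist (c s) (c t) < e.
  exact: (@metricType_numDomainType.cvgr_dist_lt _ _ _ _ _ c (c s) (cc s) e e0).
move=> /nbhs_ballP[d /= d0 dP].
by exists d => // t st; exact: dP.
Qed.

Lemma height_continuous_dist h x (e : R) : continuous h -> 0 < e ->
  exists2 d, 0 < d & forall y, mdist x y < d -> `|h x - h y| < e.
Proof.
move=> ch e0.
have /cvgrPdist_lt/(_ e e0)/nbhs_ballP[d /= d0 dP] : h y @[y --> x] --> h x by exact: ch.
by exists d => // t st; apply: dP; rewrite ballEmdist.
Qed.

Lemma mdist_lipschitz (z x y : X) : `|mdist z x - mdist z y| <= mdist x y.
Proof.
rewrite ler_norml; apply/andP; split.
  by rewrite lerNl opprB lerBlDl; exact: metric_triangle.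
rewrite lerBlDl (metric_sym x); exact: metric_triangle.
Qed.

(** A connected set containing u and v contains every point between them on the
arc, because its set of parameters is an interval. *)
Lemma turning_between c h : arc_chart c h -> bounded_turning X ->
  exists2 B : R, 1 <= B & forall u v y,
    h u <= h y <= h v \/ h v <= h y <= h u -> mdist u y <= B * mdist u v.
Proof.
move=> [_ ch _ hK _] [B B1 bt]; exists B => // u v y yb.
have [E [_ cE Eu Ev diamE]] := bt u v.
have itvE : is_interval (h @` E).
  apply/connected_intervalP/connected_continuous_connected => //.
  exact: continuous_subspaceT.
have [z Ez /(can_inj hK) zy] : (h @` E) (h y).
  have hu : (h @` E) (h u) by exists u.
  have hv : (h @` E) (h v) by exists v.
  by case: yb; [exact: itvE|exact: itvE].
rewrite -lee_fin; apply: le_trans diamE; apply: ereal_sup_ubound; right.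
by exists (u, y) => //=; split => //=; rewrite -zy.
Qed.

(** Measuring the missed part through its distances to c p replaces Hausdorff
measure on the arc, which need not be sigma-finite, by Lebesgue measure. *)
Definition almost_fills c P (p q : R) := p <= q /\
  (mu [set mdist (c p) (c t) | t in [set t : R | (p <= t <= q)%R /\ ~ P (c t)]]
    < (mdist (c p) (c q) / 2)%:E)%E.

(** If P and Q were disjoint, every point of the subarc would be missed by one of
them, and by the intermediate value theorem every number between 0 and
d(c p, c q) would be the distance to c p of such a point. *)
Lemma almost_fills_meet c P Q p q : continuous c ->
  almost_fills c P p q -> almost_fills c Q p q -> exists2 x, P x & Q x.
Proof.
move=> cc [pq Pfill] [_ Qfill]; apply: contrapT => PQ.
set TP := (X in (mu X < _)%E) in Pfill; set TQ := (X in (mu X < _)%E) in Qfill.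
set d := mdist (c p) (c q).
have sub : `[0, d]%classic `<=` TP `|` TQ.
  move=> v; rewrite /= in_itv/= => /andP[v0 vd].
  have [||t tpq tv] := @IVT R (fun t => mdist (c p) (c t)) p q v pq.
  - apply: continuous_subspaceT => s; apply/cvgrPdist_lt => e e0.
    have [r r0 rP] := path_continuous_dist s cc e0.
    apply/nbhs_ballP; exists r => //= t st.
    by rewrite (le_lt_trans (mdist_lipschitz _ _ _))//; exact: rP.
  - rewrite mdistxx min_l ?max_r ?mdist_ge0//.
    by rewrite v0.
  have [Pt|nPt] := pselect (P (c t)).
    right; exists t => //; split=> // Qt.
    by apply: PQ; exists (c t).
  by left; exists t.
have : (d%:E <= mu TP + mu TQ)%E.
  apply: (le_trans _ (outer_measureU2 mu TP TQ)).
  have -> : d%:E = mu `[0, d]%classic.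
    rewrite lebesgue_measure_itv/= lte_fin; case: ltgtP (mdist_ge0 (c p) (c q)) => //.
      by rewrite -EFinB subr0.
    by move=> <-.
  exact: le_outer_measure.
by rewrite leNgt [d]splitr EFinD lteD.
Qed.

(** Rational parameters are what makes the final family countable. *)
Lemma rational_chord c s t : continuous c -> s < t -> c s <> c t ->
  exists p q : rat, [/\ s < ratr p :> R, ratr p < ratr q :> R, ratr q < t :> R &
    mdist (c s) (c t) / 2 < mdist (c (ratr p)) (c (ratr q))].
Proof.
move=> cc st cst; set d := mdist (c s) (c t).
have d0 : 0 < d by rewrite mdist_gt0; exact/eqP.
have d40 : 0 < d / 4 by rewrite divr_gt0.
have [r r0 rP] := path_continuous_dist s cc d40.
have [r' r'0 r'P] := path_continuous_dist t cc d40.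
have [|p] := @rat_in_itvoo R s (Num.min (s + r) ((s + t) / 2)).
  by rewrite lt_min; apply/andP; split; lra.
rewrite in_itv/= lt_min => /and3P[sp pr pm].
have [|q] := @rat_in_itvoo R (Num.max (t - r') ((s + t) / 2)) t.
  by rewrite gt_max; apply/andP; split; lra.
rewrite in_itv/= gt_max => /andP[/andP[qr qm] qt].
exists p, q; split=> //; first exact: lt_trans pm qm.
have dp : mdist (c s) (c (ratr p)) < d / 4.
  by apply: rP; rewrite ltr_distlC; apply/andP; split; lra.
have dq : mdist (c t) (c (ratr q)) < d / 4.
  by apply: r'P; rewrite ltr_distlC; apply/andP; split; lra.
have := metric_triangle (c s) (c (ratr p)) (c t).
have := metric_triangle (c (ratr p)) (c (ratr q)) (c t).
rewrite -/d (metric_sym (c (ratr q))); lra.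
Qed.


(** The map is total, with conditions on K only, so that it can be restricted
without a change of type. *)
Definition bilipschitz_on (L : R) K (f : R -> X) := forall x y, K x -> K y ->
  L^-1 * `|x - y| <= mdist (f x) (f y) <= L * `|x - y|.

(** The points missed by f(K) lie within B L times the length of a gap from an
end of that gap, B being the turning constant, and the chord from f a to f b is
at least (b - a) / L; hence the choice of e below. *)
Lemma bilipschitz_almost_fills c h K f (L : R) :
    arc_chart c h -> bounded_turning X -> 1 <= L -> bilipschitz_on L K f ->
    compact K -> (0 < mu K)%E ->
  exists p q : rat, almost_fills c (f @` K) (ratr p) (ratr q).
Proof.
move=> chart bt L1 fL cK K0.
have [B B1 turn] := turning_between chart bt.
have [cc ch h01 hK cK'] := chart.
have L0 : 0 < L by lra.
have B0 : 0 < B by lra.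
(* With this e, twice B L times the length of the gaps is at most
   (b - a) / (4 L), a quarter of the chord from f a to f b. *)
pose e := (8 * B * L ^+ 2)^-1.
have e0 : 0 < e by rewrite invr_gt0 !mulr_gt0// exprn_gt0.
have [a [b [Ka Kb ab Oab]]] := compact_nearly_fills_interval cK K0 e0.
have clK : closed K by apply: compact_closed => //; exact: Rhausdorff.
have fab : (b - a) / L <= mdist (f a) (f b).
  have /andP[+ _] := fL _ _ Ka Kb.
  by rewrite distrC gtr0_norm ?subr_gt0// mulrC.
have fab0 : 0 < mdist (f a) (f b).
  by apply: lt_le_trans fab; rewrite divr_gt0// subr_gt0.
pose w := h \o f.
have cw : continuous_on K w.
  move=> x r Kx r0; have [d d0 dP] := height_continuous_dist (f x) ch r0.
  exists (d / L) => [|y Ky xy]; first exact: divr_gt0.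
  apply: dP; have /andP[_] := fL _ _ Kx Ky.
  by move=> /le_lt_trans; apply; rewrite mulrC -ltr_pdivlMr.
have [p [q [pq pw qw far]]] : exists p q : rat, [/\ ratr p < ratr q :> R,
    w a < ratr p < w b \/ w b < ratr p < w a,
    w a < ratr q < w b \/ w b < ratr q < w a &
    mdist (f a) (f b) / 2 < mdist (c (ratr p)) (c (ratr q))].
  have [wab|wba|wab] := ltgtP (w a) (w b).
  - have [|p [q [ap pq qb far]]] := rational_chord cc wab.
      rewrite /w /= !hK => fE.
      by move: fab0; rewrite fE mdistxx ltxx.
    exists p, q; split=> //; first by left; rewrite ap (lt_trans pq).
      by left; rewrite qb (lt_trans ap).
    by move: far; rewrite /w/= !hK.
  - have [|p [q [ap pq qb far]]] := rational_chord cc wba.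
      rewrite /w /= !hK => fE.
      by move: fab0; rewrite fE mdistxx ltxx.
    exists p, q; split=> //; first by right; rewrite ap (lt_trans pq).
      by right; rewrite qb (lt_trans ap).
    by move: far; rewrite /w/= !hK (metric_sym (f b)).
  - move: fab0; have -> : f a = f b by apply: (can_inj hK).
    by rewrite mdistxx ltxx.
exists p, q; split; first exact: ltW.
set T := (X in mu X).
have BL0 : 0 <= B * L by rewrite mulr_ge0// ltW.
have muT : (mu T <= (2 * (B * L))%:E * mu (`]a, b[ `\` K))%E.
  apply: (@measure_near_gaps R K a b (fun x => mdist (c (ratr p)) (f x))) => //.
  move=> y [t [/andP[pt tq] nPt] <-].
  have tab : w a < t < w b \/ w b < t < w a.
    case: pw => /andP[ap pb]; case: qw => /andP[aq qb]; lra.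
  have t01 : 0 <= t <= 1.
    have /andP[? ?] : 0 <= w a <= 1 := h01 (f a).
    have /andP[? ?] : 0 <= w b <= 1 := h01 (f b).
    by case: tab => /andP[? ?]; lra.
  have ht := cK' t t01.
  have [|a' [b' [aa' b'b gab tab']]] := IVT_gap cK cw Ka Kb ab tab.
    by move=> [x Kx wx]; apply: nPt; exists x => //; rewrite -wx /w/= hK.
  exists a', b'; split=> //; have [Ka' Kb' ab' _] := gab.
  apply: (le_trans (mdist_lipschitz _ _ _)).
  apply: (@le_trans _ _ (B * mdist (f a') (f b'))).
    apply: turn; rewrite ht -!/(w _).
    by case: tab' => /andP[u1 u2]; [left|right]; rewrite !ltW.
  rewrite -mulrA ler_pM2l//; have /andP[_] := fL _ _ Ka' Kb'.
  by rewrite distrC gtr0_norm ?subr_gt0.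
apply: (le_lt_trans muT).
apply: (@le_lt_trans _ _ ((2 * (B * L)) * (e * (b - a)))%:E).
  by rewrite [leRHS]EFinM lee_wpmul2l// lee_fin mulr_ge0.
rewrite lte_fin.
have -> : 2 * (B * L) * (e * (b - a)) = (b - a) / L / 4.
  by rewrite /e; field; rewrite !lt0r_neq0.
lra.
Qed.

(** One piece is chosen for each pair of rationals, among those that almost fill
the corresponding subarc, and the empty set if there is none. *)
Lemma countable_family_meets_all_pieces :
    jordan_arc X -> bounded_turning X ->
  exists (A : nat -> set R) (f : nat -> R -> X),
    (forall n, exists L, bilipschitz_on L (A n) (f n)) /\
    forall K g (L : R), 1 <= L -> bilipschitz_on L K g -> compact K ->
      (0 < mu K)%E -> exists n x y, [/\ A n x, K y & f n x = g y].
Proof.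
move=> ja bt; have [c [h chart]] := jordan_arc_chart ja.
have [cc _ _ _ _] := chart.
pose pq n : rat * rat := odflt (0, 0) (unpickle n).
have pick n : exists Af : set R * (R -> X),
    (exists L, bilipschitz_on L Af.1 Af.2) /\
    forall K g L, bilipschitz_on L K g ->
      almost_fills c (g @` K) (ratr (pq n).1) (ratr (pq n).2) ->
      exists x y, [/\ Af.1 x, K y & Af.2 x = g y].
  have [[K [g [L [gL fill]]]]|none] := pselect (exists K g L,
      bilipschitz_on L K g /\
      almost_fills c (g @` K) (ratr (pq n).1) (ratr (pq n).2)).
    exists (K, g); split; first by exists L.
    move=> K' g' L' _ fill'.
    have [_ [x Kx <-] [y K'y yx]] := almost_fills_meet cc fill fill'.
    by exists x, y.
  exists (set0, fun=> c 0); split; first by exists 1.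
  by move=> K g L gL fill; case: none; exists K, g, L.
have [Af AfP] := choice pick.
exists (fun n => (Af n).1), (fun n => (Af n).2); split.
  by move=> n; case: (AfP n).
move=> K g L L1 gL cK K0.
have [p [q fill]] := bilipschitz_almost_fills chart bt L1 gL cK K0.
exists (pickle (p, q)); apply: (AfP _).2 gL _.
by rewrite /pq pickleK.
Qed.

End arcs.

(** * Decomposition of the arc *)

Section decomposition.
Context {R : realType}.

Local Notation mu := (@lebesgue_measure R).

Lemma lebesgue_measurable_compact_sub (E : set R) : lebesgue_measurable E ->
    (0 < completed_lebesgue_measure E)%E ->
  exists K, [/\ compact K, K `<=` E & (0 < mu K)%E].
Proof.
rewrite /lebesgue_measurable g_sigma_completed_algebra_genE.
move=> [A mA [N /negligible_outer_measure N0 <-]] AN0.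
have A0 : (0 < mu A)%E.
  apply: (lt_le_trans AN0); apply: le_trans (outer_measureU2 mu A N) _.
  by rewrite [X in (_ + X)%E]N0 adde0.
move: A0; rewrite lebesgue_regularity_inner_sup//.
move=> /ereal_sup_gt[_ [K [cK KA] <-] K0].
by exists K; split=> // x /KA; left.
Qed.

Lemma hausdorff1_set0 (X : metricType R) : hausdorff1 (@set0 X) = 0%E.
Proof.
have diam0 : diam (@set0 X) = 0%E.
  rewrite /diam set0X image_set0 setU0; exact: ereal_sup1.
have diam_ge0 (F : set X) : (0 <= diam F)%E.
  by apply: ereal_sup_ubound; left.
have pre0 d : 0 < d -> hausdorff1_pre d (@set0 X) = 0%E.
  move=> d0; apply/eqP; rewrite eq_le; apply/andP; split; last first.
    by apply: le_ereal_inf_tmp => _ [F _ <-]; apply: nneseries_ge0 => k _ _.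
  apply: ereal_inf_lbound; exists (fun=> set0).
    by split=> // k; rewrite diam0 lee_fin ltW.
  by apply: eseries0 => k _ _; exact: diam0.
rewrite /hausdorff1 (_ : [set _ | _ in _] = [set 0%E]) ?ereal_sup1//.
apply/seteqP; split=> [_ [d d0 <-]|_ ->]; first exact: pre0.
by exists 1; [exact: ltr01|exact/pre0/ltr01].
Qed.

Lemma countably_1_rectifiable_bigcup (X : metricType R) (A : nat -> set R)
    (f : nat -> R -> X) : (forall n, exists L, bilipschitz_on L (A n) (f n)) ->
  countably_1_rectifiable (set_type (\bigcup_n (f n @` A n))).
Proof.
move=> fL; set S := \bigcup_n (f n @` A n).
have inS n (x : set_type (A n)) : f n (set_val x) \in S.
  by apply: mem_set; exists n => //; exists (set_val x) => //; exact: set_valP.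
exists A, (fun n x => exist _ (f n (set_val x)) (inS n x)); split.
  move=> n; have [L fnL] := fL n; exists L => x y.
  have /andP[_] := fnL _ _ (set_valP x) (set_valP y).
  by rewrite distrC.
rewrite (_ : ~` _ = set0) ?hausdorff1_set0// -subset0 => -[y yS] /=.
apply; have [n _ [x Anx xy]] := set_mem yS.
exists n => //; exists (exist _ x (mem_set Anx)) => //.
exact: val_inj.
Qed.

End decomposition.

Theorem theorem2 (R : realType) (gamma : metricType R)
    (gamma_arc : jordan_arc gamma) (gamma_bt : bounded_turning gamma) :
  exists S U : set gamma,
    [/\ countably_1_rectifiable (set_type S),
        purely_1_unrectifiable (set_type U) &
        setT = S `|` U].
Proof.
have [A [f [fL meets]]] := countable_family_meets_all_pieces gamma_arc gamma_bt.
pose S := \bigcup_n (f n @` A n).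
exists S, (~` S); split; last by rewrite setUv.
  exact: countably_1_rectifiable_bigcup.
move=> [E [g [mE E0 [L L1 gL]]]].
have [K [cK KE K0]] := lebesgue_measurable_compact_sub mE E0.
have [x0 Kx0] : K !=set0.
  by apply/set0P; apply: contraTneq K0 => ->; rewrite measure0 ltxx.
have Ex0 : x0 \in E by exact/mem_set/KE.
pose toE (x : R) : set_type E := insubd (exist _ x0 Ex0) x.
have toEK x : K x -> set_val (toE x) = x.
  by move=> Kx; apply: (insubdK (exist _ x0 Ex0)); exact/mem_set/KE.
pose g' (x : R) : gamma := set_val (g (toE x)).
have gK : bilipschitz_on L K g'.
  move=> x y Kx Ky; have := gL (toE x) (toE y).
  have -> : mdist (toE x) (toE y) = `|x - y|.
    by rewrite -[LHS]/(`|set_val (toE y) - set_val (toE x)|) !toEK// distrC.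
  exact.
have [n [x [y [Ax Ky fxy]]]] := meets K g' L L1 gK cK K0.
have := set_valP (g (toE y)).
by apply; exists n => //; exists x => //; exact: fxy.
Qed.
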